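(* Let $G$ be a $3$-connected cubic graph of order $n$. If $G$ has a strong optimal orientation $D$, and $F$ is a lifting of $D$ to $I(G)$ in which every triangle $T_v$ is oriented cyclically, then $F$ is a strong optimal orientation of $I(G)$. Moreover, \[\bar{\kappa}_{\max}(I(G))=\bar{\kappa}(F)=1+\frac{4n(n-1)[\bar{\kappa}_{\max}(G)-1]+2n}{3n(3n-1)}.\]
   Context: Graphs are finite and simple; cubic means $3$-regular. For a cubic graph $G$, the inflation $I(G)$ is obtained as follows: for every vertex $v$ with neighbours $x,y,z$, take a triangle $T_v$ on new vertices $v_x,v_y,v_z$; then join $v_x$ to $x_v$ for every edge $vx$ of $G$. If $D$ is an orientation of $G$, an orientation $F$ of $I(G)$ is a lifting of $D$ if $(v,x)\in E(D)$ implies $(v_x,x_v)\in E(F)$. An orientation is strong if there is a directed path between every ordered pair of distinct vertices. For a digraph $D$ and distinct vertices $u,v$, $\kappa_D(u,v)$ is the maximum number of internally disjoint directed $u$--$v$ paths; for $D$ of order $n$, $\bar{\kappa}(D)=\frac{1}{n(n-1)}\sum_{(u,v)}\kappa_D(u,v)$ over ordered pairs of distinct vertices. $\bar{\kappa}_{\max}(G)$ is the maximum of $\bar{\kappa}(D)$ over all orientations $D$ of $G$, and an orientation attaining it is called optimal. *)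

(* Defs.v *)
From HB Require Import structures.
From mathcomp Require Export all_boot all_order all_algebra.

Set Implicit Arguments.
Unset Strict Implicit.
Unset Printing Implicit Defensive.

Import Order.TTheory GRing.Theory Num.Theory.

Local Open Scope ring_scope.

(* A simple graph is a relation [e : rel T] on a [finType] which is symmetric *)
(* and irreflexive; these two properties are hypotheses of the statement.     *)
(* A digraph on [T] is its set of arcs, of type {set T * T}.                  *)

Section Graphs.
Variables (T : finType) (e : rel T).

Definition cubic : Prop := forall v : T, #|[set x | e v x]| = 3%N.

Definition del_rel (S : {set T}) : rel T :=
  [rel x y | [&& e x y, x \notin S & y \notin S]].

Definition k_connected (k : nat) : Prop :=
  (k < #|T|)%N /\
  forall S : {set T}, (#|S| < k)%N ->
  forall x y : T, x \notin S -> y \notin S -> connect (del_rel S) x y.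

End Graphs.

Section Digraphs.
Variable T : finType.
Implicit Types (D : {set T * T}) (u v : T).

Definition arc D : rel T := [rel x y | (x, y) \in D].

Definition strong D : Prop :=
  forall x y : T, x != y -> connect (arc D) x y.

(* [p] lists the vertices after the first one, [u]. A path has no repeated    *)
(* vertex, so bounding the length of [p] by #|T| excludes no path.            *)
Definition dipath D u v (p : #|T|.-bseq T) : bool :=
  [&& path (arc D) u p, last u p == v & uniq (u :: p)].

Definition inner u v (p : #|T|.-bseq T) : {set T} :=
  [set x in u :: p | (x != u) && (x != v)].

Definition int_disjoint_dipaths D u v (P : {set #|T|.-bseq T}) : bool :=
  [forall p in P, dipath D u v p] &&
  [forall p in P, forall q in P,
     (p != q) ==> [disjoint inner u v p & inner u v q]].

Definition kappa D u v : nat :=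
  (\max_(P : {set #|T|.-bseq T} | int_disjoint_dipaths D u v P) #|P|)%N.

Definition kappa_bar D : rat :=
  (\sum_(u : T) \sum_(v : T | v != u) (kappa D u v)%:R)
    / (#|T|%:R * (#|T|%:R - 1)).

End Digraphs.

Section Orientations.
Variables (T : finType) (e : rel T).

Definition orientation (D : {set T * T}) : bool :=
  [forall x, forall y,
     if e x y then ((x, y) \in D) (+) ((y, x) \in D) else (x, y) \notin D].

(* The default value 0 is harmless: a simple graph has an orientation, and    *)
(* [kappa_bar] is nonnegative.                                                *)
Definition kappa_bar_max : rat :=
  \big[Num.max/0]_(D : {set T * T} | orientation D) kappa_bar D.

Definition optimal (D : {set T * T}) : Prop :=
  orientation D /\ kappa_bar D = kappa_bar_max.

End Orientations.

Section Inflation.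
Variables (T : finType) (e : rel T).

(* The pair (v, x) with [e v x] is the vertex v_x of the inflation.           *)
Definition inflation_vertex : finType := {p : T * T | e p.1 p.2}.

Definition inflation : rel inflation_vertex :=
  [rel a b | ((val a).1 == (val b).1) && (a != b)
          || (val b == ((val a).2, (val a).1))].

Lemma inflation_sym : symmetric inflation.
Proof.
move=> [[v x] vx] [[w y] wy]; rewrite /inflation /=; congr (_ && _ || _).
- by rewrite eq_sym.
- by rewrite eq_sym.
by rewrite !xpair_eqE andbC [w == x]eq_sym [y == v]eq_sym.
Qed.

Lemma inflation_irr : irreflexive e -> irreflexive inflation.
Proof.
move=> irr [[v x] vx]; rewrite /inflation /= !eqxx /= xpair_eqE.
by apply/negP=> /andP[/eqP vEx _]; move: vx; rewrite /= vEx irr.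
Qed.

Definition triangle (v : T) : {set inflation_vertex} :=
  [set a | (val a).1 == v].

Definition lifting (D : {set T * T})
    (F : {set inflation_vertex * inflation_vertex}) : Prop :=
  orientation inflation F /\
  forall a b : inflation_vertex, val b = ((val a).2, (val a).1) ->
    val a \in D -> (a, b) \in F.

Definition cyclic_triangle (F : {set inflation_vertex * inflation_vertex})
    (v : T) : Prop :=
  exists a b c : inflation_vertex,
    [/\ triangle v = [set a; b; c], (a, b) \in F, (b, c) \in F & (c, a) \in F].

End Inflation.

(* Main.v *)
(** In an orientation of a cubic graph, [kappa u v >= k] as soon as there are
    [k] disjoint arc sets each connecting [u] to [v], since an interior vertex
    shared by two arc-disjoint paths would have degree four.

    Write [S X] for the sum of all [kappa X u v]. For any orientation [F] of
    I(G), contracting the triangles gives an orientation [D] of G, and arc sets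
    project, so [kappa F a b <= kappa D v w] for [a] in T_v and [b] in T_w.
    Together with the degree bounds on [kappa F a b], this shows that the
    blocks T_v x T_w and T_w x T_v contribute at most
    [10 + 4 * (kappa D v w + kappa D w v)] to [S F], and each T_v x T_v at most
    [8]. Hence [S F <= 8 n + 5 n (n - 1) + 4 S D], whether or not [F] is strong.

    If [D] is strong and [F] is a lifting with cyclic triangles, equality holds:
    two internally disjoint paths from [v] to [w] lift to all four pairs formed
    by an out-port of T_v and an in-port of T_w, and inside each T_v the triangle
    and a closed walk of [D] through [v] give the two extra connections. *)

Require Import Defs.
From mathcomp Require Import all_boot all_order all_algebra.
From mathcomp Require Import zify ring.

(* [path] exports another [arc]. *)
Import Defs.

Set Implicit Arguments.
Unset Strict Implicit.
Unset Printing Implicit Defensive.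

Import Order.TTheory GRing.Theory Num.Theory.

(** * Arc-disjoint connections *)

Section Steps.
Variable T : eqType.
Implicit Types (u v s t : T) (p : seq T).

(** The arcs of the walk [u :: p]; [zip] drops the last vertex, which has no successor. *)
Definition steps u p : seq (T * T) := zip (u :: p) p.

Lemma path_steps (r : rel T) u p :
  path r u p = all (fun st => r st.1 st.2) (steps u p).
Proof. by rewrite /steps; elim: p u => //= x p IHp u; rewrite IHp. Qed.

Lemma mem_steps u p s t :
  (s, t) \in steps u p -> (s \in belast u p) && (t \in p).
Proof.
elim: p u => //= x p IHp u; rewrite inE => /orP[/eqP[-> ->]|].
  by rewrite !inE !eqxx.
by move/IHp => /andP[sp tp]; rewrite !inE sp tp !orbT.
Qed.

Lemma step_to u p t : t \in p -> exists s, (s, t) \in steps u p.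
Proof.
elim: p u => //= x p IHp u; rewrite inE => /orP[/eqP->|/(IHp x)[s st]].
  by exists u; rewrite mem_head.
by exists s; rewrite inE [X in _ || X]st orbT.
Qed.

Lemma step_from u p s : s \in u :: p -> s != last u p ->
  exists t, (s, t) \in steps u p.
Proof.
elim: p u => [|x p IHp] u /=; first by rewrite inE => ->.
rewrite inE => /orP[/eqP-> _|sp slast].
  by exists x; rewrite mem_head.
by have [t st] := IHp x sp slast; exists t; rewrite inE [X in _ || X]st orbT.
Qed.

(** If the arc is the first step, [last u p] already heads [p] and cannot recur; if it is a later
    step, [u] recurs. *)
Lemma direct_step u p : uniq (u :: p) -> (u, last u p) \in steps u p ->
  p = [:: last u p].
Proof.
case: p => //= x p /and3P[unp xnp _]; rewrite inE => /orP[/eqP[xlast]|].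
  by case: p xnp xlast {unp} => //= y p xnp xlast; rewrite -xlast mem_last in xnp.
move/mem_steps => /andP[/mem_belast ux _]; move: unp.
by rewrite ux.
Qed.

End Steps.

Section ArcDisjoint.
Variable T : finType.
Implicit Types (D A : {set T * T}) (u v x y z : T) (e : rel T).

(** Arc sets with [connect], rather than paths, so that contraction and lifting may produce walks
    with repeated vertices. *)
Definition arc_disjoint_conn D u v k : Prop :=
  exists A : 'I_k -> {set T * T},
    [/\ forall i, A i \subset D,
        forall i j, i != j -> [disjoint A i & A j]
      & forall i, connect (arc (A i)) u v].

Definition outn D u : {set T} := [set x | (u, x) \in D].
Definition inn D u : {set T} := [set x | (x, u) \in D].

Lemma kappa_witness D u v :
  exists2 P, int_disjoint_dipaths D u v P & kappa D u v = #|P|.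
Proof.
have P0 : int_disjoint_dipaths D u v set0.
  by apply/andP; split; apply/forall_inP => p; rewrite inE.
rewrite /kappa (bigop.bigmax_eq_arg _ P0).
by case: arg_maxnP => // P Pok _; exists P.
Qed.

(** A common arc starts before the last vertex and ends after the first, so disjoint interiors force
    it to go from [u] to [v]; then both paths reduce to that arc. *)
Lemma steps_disjoint D u v (p q : #|T|.-bseq T) : u != v ->
  dipath D u v p -> dipath D u v q -> p != q ->
  [disjoint inner u v p & inner u v q] ->
  [disjoint [set st in steps u p] & [set st in steps u q]].
Proof.
move=> uv /and3P[_ /eqP lp up] /and3P[_ /eqP lq uq] pq dis.
apply/pred0P => -[s t] /=; rewrite !inE; apply/negP => /andP[stp stq].
have not_last r : uniq (u :: r) -> (s, t) \in steps u r ->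
    [/\ s \in u :: r, s != last u r, t \in r & t != u].
  move=> ur /mem_steps/andP[sr tr]; split=> //; first exact: mem_belast.
    move: ur; rewrite lastI rcons_uniq => /andP[+ _].
    by apply: contraNneq => <-.
  by move: ur => /= /andP[+ _]; apply: contraNneq => <-.
have [sp slp tp tu] := not_last _ up stp.
have [sq slq tq _] := not_last _ uq stq.
have su : s = u.
  apply/eqP; apply: contraTT dis => su; apply/pred0Pn; exists s.
  by rewrite /= !inE su -[X in s != X]lp slp !andbT -!in_cons sp sq.
have tv : t = v.
  apply/eqP; apply: contraTT dis => tv; apply/pred0Pn; exists t.
  by rewrite /= !inE tv tu tp tq !orbT.
move: stp stq; rewrite su tv => stp stq.
move: pq; rewrite -val_eqE /= (direct_step up) ?lp // (direct_step uq) ?lq //.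
by rewrite eqxx.
Qed.

Lemma dipath_connect D u v (p : #|T|.-bseq T) : dipath D u v p ->
  connect (arc [set st in steps u p]) u v.
Proof.
move=> /and3P[_ /eqP lp _]; apply/connectP; exists (p : seq T) => //.
by rewrite path_steps; apply/allP => -[s t]; rewrite /arc /= inE.
Qed.

Lemma dipath_sub D u v (p : #|T|.-bseq T) : dipath D u v p ->
  [set st in steps u p] \subset D.
Proof.
move=> /and3P[+ _ _]; rewrite path_steps => /allP pD.
by apply/subsetP => -[s t]; rewrite inE => /pD.
Qed.

Lemma kappa_arc_disjoint D u v k : u != v -> k <= kappa D u v ->
  arc_disjoint_conn D u v k.
Proof.
move=> uv; have [P /andP[/forall_inP Pp /forall_inP Pdis] ->] := kappa_witness D u v.
move=> kP; pose f (i : 'I_k) := enum_val (widen_ord kP i).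
have fP i : f i \in P by exact: enum_valP.
have f_inj : injective f.
  by move=> i j /enum_val_inj/(congr1 val)/=/val_inj.
exists (fun i => [set st in steps u (f i)]); split=> [i|i j ij|i].
- exact: dipath_sub (Pp _ (fP i)).
- have fij : f i != f j by rewrite (inj_eq f_inj).
  apply: (@steps_disjoint D u v) => //; [exact: Pp | exact: Pp |].
  by have /forall_inP/(_ _ (fP j))/implyP/(_ fij) := Pdis _ (fP i).
- exact: dipath_connect (Pp _ (fP i)).
Qed.

Lemma connect_dipath A u v : connect (arc A) u v ->
  exists2 p, dipath A u v p & {subset steps u p <= A}.
Proof.
case/connectP => p0 /shortenP[p pp up _ ->].
have sz : size p <= #|T|.
  by rewrite ltnW // -[X in X <= _]/(size (u :: p)) -(card_uniqP up) max_card.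
exists (Bseq sz); first by apply/and3P; split.
by move: pp; rewrite path_steps => /allP pA [s t] /pA.
Qed.

Lemma orientation_edge e D x y : orientation e D -> (x, y) \in D -> e x y.
Proof.
by move=> /forallP/(_ x)/forallP/(_ y); case: ifP => // _ /negbTE->.
Qed.

Lemma orientation_arc e D x y : orientation e D -> e x y ->
  ((y, x) \in D) = ((x, y) \notin D).
Proof.
move=> /forallP/(_ x)/forallP/(_ y) + exy; rewrite exy.
by case: (_ \in D); case: (_ \in D).
Qed.

Lemma orientation_asym e D x y : symmetric e -> orientation e D ->
  (x, y) \in D -> (y, x) \notin D.
Proof.
move=> es eD xyD; have exy := orientation_edge eD xyD.
by rewrite (orientation_arc eD exy) xyD.
Qed.

Lemma out_in_degree e D u : symmetric e -> cubic e -> orientation e D ->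
  #|outn D u| + #|inn D u| = 3.
Proof.
move=> es ec eD; rewrite -cardsUI -(ec u).
rewrite (_ : outn D u :&: inn D u = set0) ?cards0 ?addn0; last first.
  apply/setP => x; rewrite !inE; apply/negbTE/negP => /andP[ux xu].
  by have := orientation_asym es eD ux; rewrite xu.
congr #|pred_of_set _|; apply/setP => x; rewrite !inE.
have [eux|neux] := boolP (e u x).
  by rewrite (orientation_arc eD eux) orbN.
apply/negbTE; rewrite negb_or; apply/andP; split.
  by apply: contra neux; apply: orientation_edge.
by apply: contra neux => /(orientation_edge eD); rewrite es.
Qed.

(* In a cubic graph a vertex interior to two arc-disjoint paths would have
   four neighbours. *)
Lemma arc_disjoint_kappa e D u v k : symmetric e -> cubic e ->
  orientation e D -> u != v -> arc_disjoint_conn D u v k -> k <= kappa D u v.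
Proof.
move=> es ec eD uv [A [AD Adis Acon]].
have /fin_all_exists[f fP] : forall i : 'I_k, exists p : #|T|.-bseq T,
    dipath (A i) u v p /\ {subset steps u p <= A i}.
  by move=> i; have [p] := connect_dipath (Acon i); exists p.
have no_common i j st : st \in A i -> st \in A j -> i = j.
  move=> sti stj; apply/eqP; apply: contraT => ij.
  by have /pred0P/(_ st) := Adis _ _ ij; rewrite /= sti stj.
have fS i : {subset steps u (f i) <= A i} by have [] := fP i.
have lastE i : last u (f i) = v by have [/and3P[_ /eqP]] := fP i.
(* Equal paths share their first arc, which lies in a single [A i]. *)
have f_inj : injective f.
  move=> i j fij; have [t ti] : exists t, (u, t) \in steps u (f i).
    by apply: step_from; rewrite ?mem_head // lastE.
  apply: (no_common _ _ (u, t)); first exact: fS.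
  by apply: fS; rewrite -fij.
suff Pok : int_disjoint_dipaths D u v [set f i | i : 'I_k].
  have <- : #|[set f i | i : 'I_k]| = k by rewrite card_imset // card_ord.
  by rewrite /kappa; apply: (leq_bigmax_cond (F := fun P => #|pred_of_set P|)).
apply/andP; split.
  apply/forall_inP => _ /imsetP[i _ ->]; have [/and3P[pA lp up] _] := fP i.
  apply/and3P; split=> //; apply: sub_path pA => x y; apply: (subsetP (AD i)).
apply/forall_inP => _ /imsetP[i _ ->]; apply/forall_inP => _ /imsetP[j _ ->].
apply/implyP => fij; apply/pred0P => z /=; apply/negbTE/negP => /andP[].
have ij : i != j by apply: contraNneq fij => ->.
rewrite !inE => /and3P[/orP[/eqP->|zi]]; first by rewrite eqxx.
move=> zu zv /and3P[/orP[/eqP zu'|zj] _ _]; first by rewrite zu' eqxx in zu.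
have [s si] := step_to u zi; have [s' sj] := step_to u zj.
have [t ti] : exists t, (z, t) \in steps u (f i).
  by apply: step_from; rewrite ?lastE // inE zi orbT.
have [t' tj] : exists t', (z, t') \in steps u (f j).
  by apply: step_from; rewrite ?lastE // inE zj orbT.
move/fS: si => si; move/fS: ti => ti.
move/fS: sj => sj; move/fS: tj => tj.
have sA l st : st \in A l -> st \in D by apply: (subsetP (AD l)).
have out2 : 1 < #|outn D z|.
  apply/card_gt1P; exists t, t'; rewrite !inE (sA _ _ ti) (sA _ _ tj).
  by split=> //; apply: contraNneq ij => tt'; apply/eqP; apply: (no_common _ _ _ ti); rewrite tt'.
have in2 : 1 < #|inn D z|.
  apply/card_gt1P; exists s, s'; rewrite !inE (sA _ _ si) (sA _ _ sj).
  by split=> //; apply: contraNneq ij => ss'; apply/eqP; apply: (no_common _ _ _ si); rewrite ss'.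
by have := out_in_degree z es ec eD; lia.
Qed.

Lemma connect_first (r : rel T) u v : u != v -> connect r u v ->
  exists x, r u x.
Proof.
move=> uv /connectP[[|x p]] /=; first by move=> _ uv'; rewrite uv' eqxx in uv.
by case/andP => ux _ _; exists x.
Qed.

Lemma connect_last (r : rel T) u v : u != v -> connect r u v ->
  exists x, r x v.
Proof.
move=> uv /connectP[p]; case/lastP: p => [|p x] /=.
  by move=> _ uv'; rewrite uv' eqxx in uv.
by rewrite rcons_path last_rcons => /andP[_ rx] ->; exists (last u p).
Qed.

(** Pigeonhole for the degree bounds: there [g] sends a neighbour to the arc joining it to a fixed
    end of the paths. *)
Lemma disjoint_card_le k (A : 'I_k -> {set T * T}) (g : T -> T * T) (X : {set T}) :
  (forall i j, i != j -> [disjoint A i & A j]) ->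
  (forall i, exists2 x, x \in X & g x \in A i) -> k <= #|X|.
Proof.
move=> Adis /fin_all_exists2[f fX fA].
have f_inj : injective f.
  move=> i j fij; apply/eqP; apply: contraT => ij.
  by have /pred0P/(_ (g (f i))) := Adis _ _ ij; rewrite /= fA fij fA.
rewrite -[k]card_ord -cardsT -(card_imset _ f_inj) subset_leq_card //.
by apply/subsetP => _ /imsetP[i _ ->].
Qed.

Lemma kappa_out D u v : u != v -> kappa D u v <= #|outn D u|.
Proof.
move=> uv; have [A [AD Adis Acon]] := kappa_arc_disjoint uv (leqnn (kappa D u v)).
apply: (disjoint_card_le (g := fun x => (u, x)) Adis) => i.
have [x ux] := connect_first uv (Acon i).
by exists x => //; rewrite inE; apply: (subsetP (AD i)).
Qed.

Lemma kappa_in D u v : u != v -> kappa D u v <= #|inn D v|.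
Proof.
move=> uv; have [A [AD Adis Acon]] := kappa_arc_disjoint uv (leqnn (kappa D u v)).
apply: (disjoint_card_le (g := fun x => (x, v)) Adis) => i.
have [x xv] := connect_last uv (Acon i).
by exists x => //; rewrite inE; apply: (subsetP (AD i)).
Qed.

Lemma kappa_gt0 e D u v : symmetric e -> cubic e -> orientation e D ->
  u != v -> connect (arc D) u v -> 0 < kappa D u v.
Proof.
move=> es ec eD uv con; apply: (arc_disjoint_kappa es ec eD uv).
by exists (fun=> D); split=> // i j; rewrite !ord1 eqxx.
Qed.

Lemma kappa_gt1 e D u v (A B : {set T * T}) : symmetric e -> cubic e ->
  orientation e D -> u != v -> A \subset D -> B \subset D ->
  [disjoint A & B] -> connect (arc A) u v -> connect (arc B) u v ->
  1 < kappa D u v.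
Proof.
move=> es ec eD uv AD BD AB cA cB; apply: (arc_disjoint_kappa es ec eD uv).
exists (fun i => if i == ord0 then A else B); split=> [i|i j|i]; try by case: ifP.
by case: (unliftP ord0 i) => [i'|] ->; case: (unliftP ord0 j) => [j'|] ->;
  rewrite ?eqxx ?ord1 //= disjoint_sym.
Qed.

End ArcDisjoint.


(** * The inflation of a cubic graph *)

(** An arc need only map to a walk, possibly empty, since contraction collapses the arcs of a
    triangle. *)
Lemma connect_map (T U : finType) (r : rel T) (r' : rel U) (f : T -> U) :
  (forall x y, r x y -> connect r' (f x) (f y)) ->
  forall x y, connect r x y -> connect r' (f x) (f y).
Proof.
move=> rf x _ /connectP[p rp ->]; elim: p x rp => //= y p IHp x /andP[xy yp].
exact: connect_trans (rf _ _ xy) (IHp _ yp).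
Qed.

Lemma last_step (T : eqType) (x y : T) p :
  (last x (belast y p), last y p) \in steps x (y :: p).
Proof.
elim: p x y => [|z p IHp] x y /=; first by rewrite mem_head.
by rewrite inE; apply/orP; right; apply: IHp.
Qed.

Lemma card_le2_mem (T : finType) (X : {set T}) x y z : #|X| <= 2 ->
  x \in X -> y \in X -> z \in X -> x != y -> (z == x) || (z == y).
Proof.
move=> X2 xX yX zX xy; rewrite -in_set2.
have sub : [set x; y] \subset X by apply/subsetP => t /set2P[]->.
by rewrite (_ : [set x; y] = X) //; apply/eqP; rewrite eqEcard sub cards2 xy.
Qed.

Section InflationTheory.
Variables (T : finType) (e : rel T).
Hypotheses (e_sym : symmetric e) (e_irr : irreflexive e) (e_cubic : cubic e).
Local Notation V := (inflation_vertex e).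
Implicit Types (a b c : V) (v w x y z : T) (A : {set T * T}) (Z : {set T}).

(** The involution exchanging v_x and x_v, the two ends of an edge between triangles. *)
Definition flip a : V :=
  exist (fun p => e p.1 p.2) ((val a).2, (val a).1)
    (etrans (e_sym _ _) (valP a)).

Lemma inflationE a b :
  inflation a b = ((val a).1 == (val b).1) && (a != b) || (b == flip a).
Proof. by rewrite /inflation /= -val_eqE. Qed.

Lemma flipK a : flip (flip a) = a.
Proof. by apply: val_inj; rewrite /=; case: (val a). Qed.

Lemma port_neq a : (val a).1 != (val a).2.
Proof. by apply: contraTneq (valP a) => ->; rewrite e_irr. Qed.

Lemma mem_triangle a v : (a \in triangle e v) = ((val a).1 == v).
Proof. by rewrite inE. Qed.

Lemma port_inj v : {in triangle e v &, injective (fun a => (val a).2)}.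
Proof.
move=> a b; rewrite !mem_triangle => /eqP av /eqP bv ab; apply: val_inj.
by rewrite [LHS]surjective_pairing [RHS]surjective_pairing av bv ab.
Qed.

Lemma card_triangle v : #|triangle e v| = 3.
Proof.
rewrite -(card_in_imset (@port_inj v)) -(e_cubic v); congr #|pred_of_set _|.
apply/setP => x; apply/imsetP/idP => [[a]|]; rewrite ?inE.
  by move=> /eqP <- ->; exact: valP a.
move=> vx; exists (exist (fun p => e p.1 p.2) (v, x) vx) => //.
by rewrite inE.
Qed.

(** An order on the ports of [v], independent of any orientation: sums over a triangle unfold along
    it, and [triple_rot] carries facts about the first port to the others. *)
Definition triple v a b c := uniq [:: a; b; c] /\ triangle e v =i [:: a; b; c].

Lemma triangle_triple v : exists a b c, triple v a b c.
Proof.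
have := card_triangle v; rewrite cardE.
have uE := enum_uniq (triangle e v); have mE := mem_enum (triangle e v).
case: (enum _) uE mE => [|a [|b [|c [|]]]] // uE mE _; exists a, b, c.
by split=> // x; rewrite -mE.
Qed.

Lemma triple_rot v a b c : triple v a b c -> triple v b c a.
Proof.
move=> [u m]; split; first by rewrite -(rot_uniq 1) in u.
by move=> x; rewrite m !inE orbC orbA.
Qed.

Lemma triple_port v a b c : triple v a b c -> (val a).1 = v.
Proof.
by move=> [_ m]; apply/eqP; rewrite -mem_triangle m mem_head.
Qed.

Lemma sum_triple v a b c (f : V -> nat) : triple v a b c ->
  \sum_(x in triangle e v) f x = f a + f b + f c.
Proof.
move=> [u m]; rewrite (eq_bigl _ _ m) -big_uniq //= !big_cons big_nil.
by rewrite addn0 addnA.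
Qed.

Lemma flip_notin_triangle a : flip a \notin triangle e (val a).1.
Proof. by rewrite mem_triangle /= eq_sym port_neq. Qed.

Lemma neighbours a b c v : triple v a b c ->
  uniq [:: b; c; flip a] /\ inflation a =1 mem [:: b; c; flip a].
Proof.
move=> t; have av := triple_port t; case: (t) => u m; split.
  have := flip_notin_triangle a; rewrite av m.
  move: u; rewrite /= !inE !negb_or => /and3P[/andP[_ _] -> _] /and3P[_ fb fc].
  by rewrite eq_sym fb eq_sym fc.
move=> x; rewrite inflationE av eq_sym -mem_triangle m /= !inE.
have [->|xa] /= := eqVneq x a; last by rewrite andbT orbA.
move: u; rewrite /= !inE negb_or.
by case/and3P => /andP[/negbTE-> /negbTE->].
Qed.

Lemma inflation_cubic : cubic (@inflation T e).
Proof.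
move=> a; have [b [c [d t]]] := triangle_triple (val a).1.
(* Rotate the enumeration until [a] comes first. *)
have {b c d t} [b [c t]] : exists b c, triple (val a).1 a b c.
  have : a \in [:: b; c; d] by case: t => _ <-; rewrite mem_triangle.
  rewrite !inE => /or3P[]/eqP ab; rewrite -ab in t.
  - by exists c, d.
  - by exists d, b; apply: triple_rot t.
  - by exists b, c; apply: triple_rot (triple_rot t).
have [u m] := neighbours t.
rewrite -[3]/(size [:: b; c; flip a]) -(card_uniqP u); apply: eq_card => x.
by rewrite inE m.
Qed.

(** * Orientations of the inflation that agree with [D] between triangles *)

Section Lifting.
Variables (D : {set T * T}) (F : {set V * V}).
Hypotheses (eD : orientation e D) (eF : orientation (@inflation T e) F).
Hypothesis FD : forall a, ((a, flip a) \in F) = (val a \in D).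

Let iS := @inflation_sym T e.
Let iC := inflation_cubic.

Lemma out_port v a b c : triple v a b c ->
  #|outn F a| = ((a, b) \in F) + ((a, c) \in F) + (val a \in D).
Proof.
move=> t; have [u m] := neighbours t.
transitivity (count (fun x : V => (a, x) \in F) [:: b; c; flip a]); last first.
  by rewrite /= FD addn0 addnA.
rewrite -size_filter -(card_uniqP (filter_uniq _ u)); apply: eq_card => x.
rewrite inE mem_filter; have [ax|//] := boolP ((a, x) \in F).
by have := orientation_edge eF ax; rewrite m /= => ->.
Qed.

Lemma triangle_arc v a b c : triple v a b c ->
  ((b, a) \in F) = ((a, b) \notin F).
Proof.
move=> t; apply: (orientation_arc eF); have [_ ->] := neighbours t.
by rewrite /= mem_head.
Qed.

Lemma out_ports v a b c : triple v a b c ->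
  (val a \in D) + (val b \in D) + (val c \in D) = #|outn D v|.
Proof.
move=> t; have [u m] := t.
transitivity (count (fun x => (v, x) \in D) [seq (val a).2 | a <- [:: a; b; c]]).
  have portE c' : (val c').1 = v -> (v, (val c').2) = val c'.
    by move=> <-; rewrite -surjective_pairing.
  have va := triple_port t; have vb := triple_port (triple_rot t).
  have vc := triple_port (triple_rot (triple_rot t)).
  by rewrite /= addn0 addnA !portE.
rewrite -size_filter -(card_uniqP (filter_uniq _ _)).
  apply: eq_card => x; rewrite mem_filter [RHS]inE.
  have [vx|//] := boolP ((v, x) \in D).
  have evx := orientation_edge eD vx.
  rewrite andTb; apply/mapP; exists (exist (fun p => e p.1 p.2) (v, x) evx) => //.
  by rewrite -m mem_triangle.
rewrite map_inj_in_uniq // => x y xm ym; apply: (@port_inj v); by rewrite m.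
Qed.

(** Each edge of the triangle contributes 1 whichever way it points; the remaining arcs correspond
    to those of [D] leaving [v]. *)
Lemma out_degrees v a b c : triple v a b c ->
  #|outn F a| + #|outn F b| + #|outn F c| = 3 + #|outn D v|.
Proof.
move=> t; have t' := triple_rot t; have t'' := triple_rot t'.
rewrite (out_port t) (out_port t') (out_port t'') -(out_ports t).
rewrite (triangle_arc t) (triangle_arc t') (triangle_arc t'').
by do 3!case: (_ \in F); do 3!case: (_ \in D).
Qed.

(** Contract the triangles: arcs inside a triangle become trivial, and distinct arcs between
    triangles keep distinct images in [D], so disjointness survives. *)
Lemma kappa_inflation_le a b : (val a).1 != (val b).1 ->
  kappa F a b <= kappa D (val a).1 (val b).1.
Proof.
move=> ab; apply: (arc_disjoint_kappa e_sym e_cubic eD ab).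
have ab' : a != b by apply: contraNneq ab => ->.
have [A [AF Adis Acon]] := kappa_arc_disjoint ab' (leqnn (kappa F a b)).
exists (fun i => [set val c | c : V & (c, flip c) \in A i]); split=> [i|i j ij|i].
- apply/subsetP => _ /imsetP[c + ->]; rewrite inE -FD; exact: (subsetP (AF i)).
- apply/pred0P => x /=; apply/negbTE/negP => /andP[].
  case/imsetP => c; rewrite inE => ci -> /imsetP[d + /val_inj cd].
  by rewrite inE -cd => cj; have /pred0P/(_ (c, flip c)) := Adis _ _ ij; rewrite /= ci cj.
- apply: (connect_map (r := arc (A i)) (f := fun c : V => (val c).1)) (Acon i).
  move=> x y xy; have := orientation_edge eF (subsetP (AF i) _ xy).
  rewrite inflationE => /orP[/andP[/eqP-> _]|/eqP yx]; first exact: connect0.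
  apply: connect1; rewrite yx /= /arc /=; apply/imsetP; exists x.
    by rewrite inE -yx.
  by case: (val x).
Qed.

(** The part of [F] available to a walk with arcs in [A] that may turn inside the triangles at
    [Z]. *)
Definition inflate (A : {set T * T}) (Z : {set T}) : {set V * V} :=
  [set ab in F | (ab.2 == flip ab.1) && (val ab.1 \in A)
    || ((val ab.1).1 == (val ab.2).1) && ((val ab.1).1 \in Z)].

Lemma inflate_sub A Z : inflate A Z \subset F.
Proof. by apply/subsetP => ab; rewrite inE => /andP[]. Qed.

(** An arc between triangles never lies inside one, because a port has [(val a).1 != (val a).2];
    hence the two kinds of arcs can be compared separately. *)
Lemma inflate_disjoint A A' Z Z' : [disjoint A & A'] -> [disjoint Z & Z'] ->
  [disjoint inflate A Z & inflate A' Z'].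
Proof.
move=> dA dZ; apply/pred0P => -[a b] /=; rewrite !inE /=.
apply/negbTE/negP => /andP[/andP[_ H] /andP[_ H']].
move: H H' => /orP[/andP[/eqP->]|/andP[/eqP ab]] + /orP[/andP[+]|/andP[+]].
- by move=> aA _ aA'; have /pred0P/(_ (val a)) := dA; rewrite /= aA aA'.
- by move=> _; rewrite /= (negbTE (port_neq a)).
- by move=> _ /eqP ba; move: (port_neq a); rewrite ab ba /= eqxx.
- by move=> aZ _ aZ'; have /pred0P/(_ (val a).1) := dZ; rewrite /= aZ aZ'.
Qed.

Hypothesis F_cyc : forall v, cyclic_triangle F v.

Lemma inflate_triangle A Z a b : (val a).1 = (val b).1 -> (val a).1 \in Z ->
  connect (arc (inflate A Z)) a b.
Proof.
move=> ab aZ; have [x [y [z [txyz xy yz zx]]]] := F_cyc (val a).1.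
have in3 c : (c \in [set x; y; z]) = ((val c).1 == (val a).1).
  by rewrite -txyz mem_triangle.
have step c d : c \in [set x; y; z] -> d \in [set x; y; z] -> (c, d) \in F ->
    connect (arc (inflate A Z)) c d.
  rewrite !in3 => /eqP ca /eqP da cd; apply: connect1.
  by rewrite /arc /= inE /= cd ca da eqxx aZ orbT.
have [x3 y3 z3] : [/\ x \in [set x; y; z], y \in [set x; y; z] & z \in [set x; y; z]].
  by rewrite !inE !eqxx !orbT.
have {}xy := step _ _ x3 y3 xy; have {}yz := step _ _ y3 z3 yz.
have {}zx := step _ _ z3 x3 zx.
have xz := connect_trans xy yz; have yx := connect_trans yz zx.
have zy := connect_trans zx xy.
have : a \in [set x; y; z] by rewrite in3.
have : b \in [set x; y; z] by rewrite in3 ab.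
by rewrite !inE -!orbA => /or3P[]/eqP-> /or3P[]/eqP->.
Qed.

Lemma inflate_flip A Z a : A \subset D -> val a \in A ->
  arc (inflate A Z) a (flip a).
Proof.
move=> /subsetP AD aA; have := AD _ aA; move: aA.
by rewrite /arc /= inE FD /= eqxx => -> ->.
Qed.

(** Alternately cross to the next triangle by [flip] and turn there to the port of the next arc.
    Turns occur only strictly between the ends, hence [belast y p]. *)
Lemma inflate_path A Z p x y a : A \subset D -> path (arc A) x (y :: p) ->
  val a = (x, y) -> {subset belast y p <= Z} ->
  exists2 b, val b = (last y p, last x (belast y p))
           & connect (arc (inflate A Z)) a b.
Proof.
move=> AD; elim: p x y a => [|z p IHp] x y a xyp axy pZ; case/andP: xyp => xy yp.
  exists (flip a); first by rewrite /= axy.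
  by apply/connect1/inflate_flip; rewrite ?axy.
have yz : (y, z) \in A by case/andP: yp.
have eyz := orientation_edge eD (subsetP AD _ yz).
pose b : V := exist (fun p => e p.1 p.2) (y, z) eyz.
have [|c cE bc] := IHp y z b yp erefl; first by move=> t tp; rewrite pZ // inE tp orbT.
exists c => //; apply: connect_trans bc.
apply: (@connect_trans _ _ (flip a)).
  by apply/connect1/inflate_flip; rewrite ?axy.
by apply: inflate_triangle; rewrite /= axy // pZ // mem_head.
Qed.

(** At an end, a turn is needed only if the given port is not the one used by the walk. The walk may
    be closed, as in [kappa_triangle]. *)
Lemma inflate_connect A Z p x y a b : A \subset D -> path (arc A) x (y :: p) ->
  (val a).1 = x -> (val b).1 = last y p -> {subset belast y p <= Z} ->
  (val a == (x, y)) || (x \in Z) ->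
  (val b == (last y p, last x (belast y p))) || (last y p \in Z) ->
  connect (arc (inflate A Z)) a b.
Proof.
move=> AD xp ax bp pZ exit entry.
have xy : (x, y) \in A by case/andP: xp.
have exy := orientation_edge eD (subsetP AD _ xy).
pose a' : V := exist (fun p => e p.1 p.2) (x, y) exy.
have [b' b'E ab'] := inflate_path AD xp (erefl : val a' = (x, y)) pZ.
apply: (@connect_trans _ _ a').
  case/orP: exit => [/eqP aE|xZ]; last by apply: inflate_triangle; rewrite ?ax.
  by rewrite (_ : a = a') ?connect0 //; apply: val_inj.
apply: (connect_trans ab').
case/orP: entry => [/eqP bE|lZ]; last by apply: inflate_triangle; rewrite b'E.
by rewrite (_ : b' = b) ?connect0 //; apply: val_inj; rewrite bE.
Qed.

(** Thus [val a \notin D] characterizes the in-ports. *)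
Lemma val_in a : (((val a).2, (val a).1) \in D) = (val a \notin D).
Proof. by rewrite (orientation_arc eD (valP a)) -surjective_pairing. Qed.

(* The triangle at an end belongs to the path that does not use the port given
   there; as the degree is at most two, one of the two paths does use it. *)
Lemma kappa_lift a b : let v := (val a).1 in let w := (val b).1 in
  v != w -> #|outn D v| <= 2 -> #|inn D w| <= 2 ->
  val a \in D -> val b \notin D -> 1 < kappa D v w -> 1 < kappa F a b.
Proof.
move=> v w vw out2 in2 aD bD.
have [P /andP[/forall_inP Pp /forall_inP Pdis] ->] := kappa_witness D v w.
case/card_gt1P => p [q [pP qP pq]].
have := Pdis _ pP => /forall_inP/(_ _ qP)/implyP/(_ pq) ipq.
have dp := Pp _ pP; have dq := Pp _ qP.
have spq := steps_disjoint vw dp dq pq ipq.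
have ab : a != b by apply: contraNneq vw => ab; rewrite /v ab.
(* The vertex after [v] and the vertex before [w] on the path; the latter is [v] itself when the
   path is a single arc. An empty [r] cannot occur, as [v != w]. *)
pose first (r : seq T) := head v r.
pose penult (r : seq T) := last v (belast (head v r) (behead r)).
pose Z (r : #|T|.-bseq T) := inner v w r
  :|: [set z | (z == v) && (val a != (v, first r))]
  :|: [set z | (z == w) && (val b != (w, penult r))].
have key r : dipath D v w r -> [/\ (v, first r) \in steps v r,
    (penult r, w) \in steps v r &
    connect (arc (inflate [set st in steps v r] (Z r))) a b].
  move=> dr; have sD := dipath_sub dr; case/and3P: (dr) => rp /eqP rl ru.
  case rE : (r : seq T) => [|y r'].
    by move: rl; rewrite rE /= => vw'; rewrite vw' eqxx in vw.
  rewrite rE in rp rl ru; split; first by rewrite /first /= mem_head.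
    by have := last_step v y r'; rewrite [last y r']rl.
  have yl : last y r' = w := rl.
  apply: (@inflate_connect _ _ r' v y) => //.
  - by rewrite -rE.
  - by rewrite path_steps; apply/allP => -[s t] st; rewrite /arc /= inE.
  - move=> z zr; rewrite !inE; apply/orP; left; apply/orP; left.
    have zyr := mem_belast zr; rewrite rE zyr orbT /=.
    move: ru; rewrite /= => /andP[vr yr]; apply/andP; split.
      by apply: contraNneq vr => <-.
    move: yr; rewrite -/(uniq (y :: r')) lastI rcons_uniq yl => /andP[+ _].
    by apply: contraNneq => <-.
  - by rewrite !inE /first rE /= eqxx /=; case: (val a == _); rewrite ?orbT.
  - by rewrite yl !inE /penult rE /= [w == w]eqxx /=; case: (val b == _); rewrite ?orbT.
have [fp lp cp] := key _ dp; have [fq lq cq] := key _ dq.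
have sub r st : dipath D v w r -> st \in steps v r -> st \in D.
  by move=> dr st_r; apply: (subsetP (dipath_sub dr)); rewrite inE.
have no_common st : st \in steps v p -> st \in steps v q -> False.
  by move=> stp stq; have /pred0P/(_ st) := spq; rewrite /= !inE stp stq.
have aE x : (val a == (v, x)) = ((val a).2 == x).
  by rewrite [val a]surjective_pairing xpair_eqE eqxx.
have bE x : (val b == (w, x)) = ((val b).2 == x).
  by rewrite [val b]surjective_pairing xpair_eqE eqxx.
have exits : (val a == (v, first p)) || (val a == (v, first q)).
  rewrite !aE; apply: (card_le2_mem out2); rewrite ?inE.
  - exact: sub dp fp.
  - exact: sub dq fq.
  - by rewrite -surjective_pairing.
  - by apply/negP => /eqP pq1; apply: (no_common _ fp); rewrite pq1.
have entries : (val b == (w, penult p)) || (val b == (w, penult q)).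
  rewrite !bE; apply: (card_le2_mem in2); rewrite ?inE.
  - exact: sub dp lp.
  - exact: sub dq lq.
  - by rewrite val_in.
  - by apply/negP => /eqP pq1; apply: (no_common _ lp); rewrite pq1.
apply: (kappa_gt1 iS iC eF ab (inflate_sub _ _) (inflate_sub _ _) _ cp cq).
apply: inflate_disjoint => //; apply/pred0P => z /=; apply/negbTE.
rewrite !inE; have [->|zv] := eqVneq z v.
  by move: exits; rewrite (negbTE vw); do 2!case: (val a == _).
have [->|zw] := eqVneq z w.
  by move: entries; do 2!case: (val b == _) => //=; rewrite !andbF.
have /pred0P/(_ z) := ipq; rewrite /= !inE zv zw (negbTE zv) /= !andbT !orbF.
by move=> ->.
Qed.

Hypothesis D_strong : strong D.

Lemma inflation_strong : strong F.
Proof.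
move=> a b ab.
suff : connect (arc (inflate D setT)) a b.
  by apply: connect_sub => x y xy; apply: connect1; apply: (subsetP (inflate_sub D setT)).
have [abv|abv] := eqVneq (val a).1 (val b).1.
  by apply: inflate_triangle; rewrite ?inE.
case/connectP: (D_strong abv) => -[|y p] pp lp; first by rewrite lp eqxx in abv.
by apply: (@inflate_connect D setT p (val a).1 y); rewrite ?inE ?orbT // => z; rewrite inE.
Qed.

Lemma strong_out v : 0 < #|outn D v|.
Proof.
have : 0 < #|[set x | e v x]| by rewrite e_cubic.
case/card_gt0P => w; rewrite inE => vw.
have nvw : v != w by apply: contraTneq vw => ->; rewrite e_irr.
by have [x vx] := connect_first nvw (D_strong nvw); apply/card_gt0P; exists x; rewrite inE.
Qed.

Lemma strong_in v : 0 < #|inn D v|.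
Proof.
have : 0 < #|[set x | e v x]| by rewrite e_cubic.
case/card_gt0P => w; rewrite inE => vw.
have nvw : w != v by apply: contraTneq vw => ->; rewrite e_irr.
by have [x xv] := connect_last nvw (D_strong nvw); apply/card_gt0P; exists x; rewrite inE.
Qed.

(* One connection is the triangle itself; the other lifts a closed walk through
   [v] that leaves by [a] and returns by [b]. Strongness gives this walk because
   [v] has either a unique out-neighbour or a unique in-neighbour. *)
Lemma kappa_triangle a b : (val a).1 = (val b).1 -> val a \in D ->
  val b \notin D -> 1 < kappa F a b.
Proof.
move=> abv aD bD; set v := (val a).1.
have ab : a != b by apply: contraNneq bD => <-.
pose x := (val a).2; pose y := (val b).2.
have vx : (v, x) \in D by rewrite -surjective_pairing.
have yv : (y, v) \in D by rewrite /v abv val_in.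
have degs := out_in_degree v e_sym e_cubic eD.
have out0 := strong_out v; have in0 := strong_in v.
have vx' : v != x := port_neq a.
have vy' : v != y by rewrite /v abv port_neq.
have aE : val a = (v, x) by exact: surjective_pairing.
have bE : val b = (v, y) by rewrite /v abv; exact: surjective_pairing.
have uniq1 (X : {set T}) s t : #|X| <= 1 -> s \in X -> t \in X -> s = t.
  by move=> /card_le1_eqP X1 sX tX; apply: X1.
have [p [pp lp bp vp]] : exists p, [/\ path (arc D) v (x :: p), last x p = v,
    last v (belast x p) = y & v \notin belast x p].
  have [out1|in1] : #|outn D v| <= 1 \/ #|inn D v| <= 1 by lia.
    (* Unique out-neighbour: a path from [v] to [y] must begin with [x], and the arc from [y] to [v]
       closes it. *)
    have /connectP[p0 /shortenP[p pp up _] lp] := D_strong vy'.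
    case: p pp up lp => [|x' p] pp up lp; first by rewrite lp eqxx in vy'.
    have x'x : x' = x.
      by apply: (uniq1 _ _ _ out1); rewrite inE //; case/andP: pp.
    exists (rcons p v); rewrite last_rcons belast_rcons.
    rewrite -x'x -rcons_cons rcons_path pp -lp; split=> //.
    by case/andP: up.
  (* Unique in-neighbour: a path from [x] to [v] must end with the arc from [y]. *)
  have /connectP[p0 /shortenP[p pp up _] lp] : connect (arc D) x v.
    by apply: D_strong; rewrite eq_sym.
  have ppv : path (arc D) v (x :: p) by rewrite /= [arc D v x]vx.
  exists p; split=> //.
    apply: (uniq1 _ _ _ in1); rewrite inE // {2}lp.
    have := last_step v x p; move: ppv; rewrite path_steps => /allP all_D.
    by move/all_D.
  by move: up; rewrite lastI rcons_uniq -lp => /andP[].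
(* The closed walk may turn in every triangle except the one at [v], which is reserved for the other
   connection. *)
apply: (@kappa_gt1 _ _ F a b (inflate D (~: [set v])) (inflate set0 [set v]) iS iC eF ab);
  rewrite ?inflate_sub //.
- by apply: inflate_disjoint; apply/pred0P => z; rewrite /= !inE ?andbF ?andNb.
- apply: (@inflate_connect _ _ p v x) => //; rewrite ?lp ?bp ?aE ?bE ?eqxx //.
  by move=> z zp; rewrite !inE; apply: contraNneq vp => <-.
- by apply: inflate_triangle; rewrite ?inE.
Qed.
End Lifting.

(** * Counting *)

(** The sum [S X], that is, the numerator of [kappa_bar], kept as a natural number. *)
Definition total (U : finType) (X : {set U * U}) : nat :=
  \sum_u \sum_(v | v != u) kappa X u v.

Lemma sum_sym (f : T -> T -> nat) :
  \sum_v \sum_(w | w != v) f w v = \sum_v \sum_(w | w != v) f v w.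
Proof.
rewrite (exchange_big_dep predT) //=; apply: eq_bigr => v _.
by apply: eq_bigl => w; rewrite eq_sym.
Qed.

Lemma sum_const_neq k : \sum_(v : T) \sum_(w | w != v) k = k * (#|T| * #|T|.-1).
Proof.
under eq_bigr do rewrite sum_nat_const -[#|_|]/#|predC1 _| cardC1.
by rewrite sum_nat_const mulnA mulnC.
Qed.

Lemma sum_triple2 v w a b c a' b' c' (f : V -> V -> nat) :
  triple v a b c -> triple w a' b' c' ->
  \sum_(p in triangle e v) \sum_(q in triangle e w) f p q
    = f a a' + f a b' + f a c' + (f b a' + f b b' + f b c')
      + (f c a' + f c b' + f c c').
Proof. by move=> t t'; rewrite (sum_triple _ t) !(sum_triple _ t'). Qed.

(** * Upper and lower bounds for the blocks T_v x T_w *)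

Section Blocks.
Variables (D : {set T * T}) (F : {set V * V}).
Hypotheses (eD : orientation e D) (eF : orientation (@inflation T e) F).
Hypothesis FD : forall a, ((a, flip a) \in F) = (val a \in D).

Let iS := @inflation_sym T e.
Let iC := inflation_cubic.

(** The factor [b != a] removes the terms with equal ends, so that one formula also serves
    [v = w]. *)
Definition block v w : nat :=
  \sum_(a in triangle e v) \sum_(b in triangle e w) (b != a) * kappa F a b.

Lemma total_blocks :
  total F = \sum_v block v v + \sum_v \sum_(w | w != v) block v w.
Proof.
rewrite -big_split /= /total (partition_big (fun a => (val a).1) predT) //=.
apply: eq_bigr => v _.
rewrite -(bigD1 (P := predT) (F := block v) v) //= /block exchange_big /=.
apply: eq_big => [a|a _]; first by rewrite inE.
rewrite (partition_big (fun b => (val b).1) predT) //=; apply: eq_bigr => w _.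
rewrite big_mkcond [RHS]big_mkcond; apply: eq_bigr => b _.
by rewrite inE; case: (b != a); case: (_ == w); rewrite ?mul1n.
Qed.

Lemma block_diag v a b c : triple v a b c ->
  block v v = kappa F a b + kappa F a c + kappa F b a + kappa F b c
              + kappa F c a + kappa F c b.
Proof.
move=> t; rewrite /block (sum_triple2 (fun x y : V => (y != x) * kappa F x y) t t).
move: (kappa F) => k; case: t => /= + _.
rewrite !inE negb_or => /and3P[/andP[ab ac] bc _].
rewrite !eqxx [b == a]eq_sym [c == a]eq_sym [c == b]eq_sym ab ac bc.
by rewrite /= !mul1n !mul0n !addn0 !add0n !addnA.
Qed.

Lemma block_off v w a b c a' b' c' : v != w -> triple v a b c ->
  triple w a' b' c' ->
  block v w = kappa F a a' + kappa F a b' + kappa F a c'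
            + (kappa F b a' + kappa F b b' + kappa F b c')
            + (kappa F c a' + kappa F c b' + kappa F c c').
Proof.
move=> vw t t'; rewrite /block.
transitivity (\sum_(p in triangle e v) \sum_(q in triangle e w) kappa F p q).
  apply: eq_bigr => x; rewrite inE => /eqP xv; apply: eq_bigr => y.
  rewrite inE => /eqP yw; suff -> : y != x by rewrite mul1n.
  by apply: contraNneq vw => yx; rewrite -xv -yw yx.
exact: sum_triple2.
Qed.

(** Each term is at most the out-degree of its start and the in-degree of its end, which is 3 minus
    its out-degree. The bound is checked for all 64 choices of out-degrees; 1, 1, 2 reaches it. *)
Lemma block_diag_le v : block v v <= 8.
Proof.
have [a [b [c t]]] := triangle_triple v; rewrite (block_diag t).
have deg (x : V) : #|outn F x| + #|inn F x| = 3 := out_in_degree x iS iC eF.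
have := deg a; have := deg b; have := deg c.
case: t => /= + _; rewrite !inE negb_or => /and3P[/andP[ab ac] bc _].
have bound (x y : V) : x != y -> kappa F x y <= minn #|outn F x| #|inn F y|.
  by move=> xy; rewrite leq_min kappa_out ?kappa_in.
have := bound a b ab; have := bound a c ac; have := bound b c bc.
rewrite eq_sym in ab; rewrite eq_sym in ac; rewrite eq_sym in bc.
have := bound b a ab; have := bound c a ac; have := bound c b bc.
move: #|outn F a| #|outn F b| #|outn F c| => oa ob oc.
move: #|inn F a| #|inn F b| #|inn F c| => ja jb jc.
move: (kappa F a b) (kappa F a c) (kappa F b a) => k1 k2 k3.
move: (kappa F b c) (kappa F c a) (kappa F c b) => k4 k5 k6.
move=> b1 b2 b3 b4 b5 b6 ec' eb' ea'.
have [jaE jbE jcE] : [/\ ja = 3 - oa, jb = 3 - ob & jc = 3 - oc] by split; lia.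
have [oa3 ob3 oc3] : [/\ oa < 4, ob < 4 & oc < 4] by split; lia.
rewrite {}jaE {}jbE {}jcE {ea' eb' ec'} in b1 b2 b3 b4 b5 b6 *.
case: oa oa3 b1 b2 b3 b4 b5 b6 => [|[|[|[|//]]]] _;
  case: ob ob3 => [|[|[|[|//]]]] _;
  case: oc oc3 => [|[|[|[|//]]]] _; rewrite /minn /=; lia.
Qed.

(** The out-degrees in T_v add up to [3 + #|outn D v|], at most 6, which gives 18. In the last case
    they add up to at most 5, and so do the in-degrees in T_w: some row and some column of the nine
    terms are bounded by 1, the other four terms by 2, and 5 + 8 = 13. *)
Lemma block_off_le v w : v != w -> let k := kappa D v w in
  [/\ block v w <= 9 * k, block v w <= 18
    & k <= 2 -> #|outn D v| <= 2 -> #|inn D w| <= 2 -> block v w <= 13].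
Proof.
move=> vw k; have [a [b [c t]]] := triangle_triple v.
have [a' [b' [c' t']]] := triangle_triple w; rewrite (block_off vw t t').
have Ho := out_degrees eD eF FD t; have Ho' := out_degrees eD eF FD t'.
have deg (x : V) : #|outn F x| + #|inn F x| = 3 := out_in_degree x iS iC eF.
have degv := out_in_degree v e_sym e_cubic eD.
have degw := out_in_degree w e_sym e_cubic eD.
have da := deg a'; have db := deg b'; have dc := deg c'.
have bound (x y : V) : (val x).1 = v -> (val y).1 = w ->
    [/\ kappa F x y <= k, kappa F x y <= #|outn F x| & kappa F x y <= #|inn F y|].
  move=> xv yw; have xy : x != y by apply: contraNneq vw => xy; rewrite -xv -yw xy.
  by rewrite kappa_out ?kappa_in // /k -xv -yw kappa_inflation_le // xv yw.
have va := triple_port t; have vb := triple_port (triple_rot t).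
have vc := triple_port (triple_rot (triple_rot t)).
have wa := triple_port t'; have wb := triple_port (triple_rot t').
have wc := triple_port (triple_rot (triple_rot t')).
have [? ? ?] := bound _ _ va wa; have [? ? ?] := bound _ _ va wb.
have [? ? ?] := bound _ _ va wc; have [? ? ?] := bound _ _ vb wa.
have [? ? ?] := bound _ _ vb wb; have [? ? ?] := bound _ _ vb wc.
have [? ? ?] := bound _ _ vc wa; have [? ? ?] := bound _ _ vc wb.
have [? ? ?] := bound _ _ vc wc.
clear bound deg va vb vc wa wb wc.
split=> [||k2 o2 i2]; [by lia | by lia |].
have [o1|[o1|o1]] : #|outn F a| <= 1 \/ #|outn F b| <= 1 \/ #|outn F c| <= 1 by lia.
all: have [i1|[i1|i1]] : #|inn F a'| <= 1 \/ #|inn F b'| <= 1 \/ #|inn F c'| <= 1 by lia.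
all: lia.
Qed.

(* A source or a sink may exceed [5 + 4 * kappa] in one direction, by at most
   what it loses in the other, where [kappa] vanishes. *)
Lemma block_pair_le v w : v != w ->
  block v w + block w v <= 10 + 4 * (kappa D v w + kappa D w v).
Proof.
move=> vw; have wv : w != v by rewrite eq_sym.
have [h1 h2 h3] := block_off_le vw; have [h1' h2' h3'] := block_off_le wv.
have := out_in_degree v e_sym e_cubic eD; have := out_in_degree w e_sym e_cubic eD.
have := kappa_out D vw; have := kappa_in D vw.
have := kappa_out D wv; have := kappa_in D wv.
move: h1 h2 h3 h1' h2' h3'; rewrite /=.
move: (kappa D v w) (kappa D w v) (block v w) (block w v) => k k' B B'.
move: #|outn D v| #|inn D v| #|outn D w| #|inn D w| => ov iv ow iw.
move=> h1 h2 h3 h1' h2' h3' *.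
(* If one direction vanishes, so does its block; the other is at most [9 * k'] and 18, hence at most
   [10 + 4 * k']. The next line is symmetric. *)
have [k0|k0] := posnP k; first by lia.
have [k0'|k0'] := posnP k'; first by lia.
(* Both are now positive, so all four degrees are 1 or 2 and [k], [k'] are at most 2: the bounds 9
   and 13 are [5 + 4 * k] for [k] equal to 1 and 2. *)
have {}h3 := h3 ltac:(lia) ltac:(lia) ltac:(lia).
have {}h3' := h3' ltac:(lia) ltac:(lia) ltac:(lia).
lia.
Qed.

Lemma total_inflation_le :
  total F <= 8 * #|T| + 5 * (#|T| * #|T|.-1) + 4 * total D.
Proof.
rewrite total_blocks -addnA leq_add //.
  rewrite mulnC -sum_nat_const; apply: leq_sum => v _; exact: block_diag_le.
(* Only sums of opposite blocks are bounded, so the off-diagonal sum is doubled and one copy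
   transposed. *)
rewrite -(leq_pmul2l (m := 2)) // mulSn mul1n -[X in _ + X <= _]sum_sym -big_split /=.
apply: (@leq_trans (\sum_v \sum_(w | w != v) (10 + 4 * (kappa D v w + kappa D w v)))).
  apply: leq_sum => v _; rewrite -big_split /=; apply: leq_sum => w.
  by rewrite eq_sym; apply: block_pair_le.
under eq_bigr do rewrite big_split /= -big_distrr big_split /=.
rewrite big_split /= -big_distrr big_split /= (sum_sym (kappa D)) sum_const_neq /total /=.
lia.
Qed.

Hypotheses (F_cyc : forall v, cyclic_triangle F v) (D_strong : strong D).

Lemma strong_degrees v : (#|outn D v| <= 2) && (#|inn D v| <= 2).
Proof.
have := out_in_degree v e_sym e_cubic eD.
have := strong_out D_strong v; have := strong_in D_strong v; lia.
Qed.

Lemma inflation_kappa_gt0 a b : a != b -> 0 < kappa F a b.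
Proof.
by move=> ab; apply: (kappa_gt0 iS iC eF ab); apply: (inflation_strong eD FD F_cyc).
Qed.

(** All six terms are at least 1. There are one or two out-ports among three, hence two pairs of an
    out-port and an in-port, each gaining 1 by [kappa_triangle]. *)
Lemma block_diag_ge v : 8 <= block v v.
Proof.
have [a [b [c t]]] := triangle_triple v; rewrite (block_diag t).
have va := triple_port t; have vb := triple_port (triple_rot t).
have vc := triple_port (triple_rot (triple_rot t)).
have bound (x y : V) : x != y -> (val x).1 = v -> (val y).1 = v ->
    1 + (val x \in D) * (val y \notin D) <= kappa F x y.
  move=> xy xv yv; have := inflation_kappa_gt0 xy.
  have [xD|//] := boolP (val x \in D); have [//|yD] := boolP (val y \in D) => _.
  by apply: (kappa_triangle eD eF FD) => //; rewrite xv yv.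
have := out_ports eD t; have /andP[o2 i2] := strong_degrees v.
have o1 := strong_out D_strong v.
case: t => /= + _; rewrite !inE negb_or => /and3P[/andP[ab ac] bc _].
have := bound a b ab va vb; have := bound a c ac va vc; have := bound b c bc vb vc.
rewrite eq_sym in ab; rewrite eq_sym in ac; rewrite eq_sym in bc.
have := bound b a ab vb va; have := bound c a ac vc va; have := bound c b bc vc vb.
do 3!case: (_ \in D); rewrite /=; lia.
Qed.

(** Nine positive terms suffice if [kappa D v w] is at most 1. Otherwise it is 2, there are two
    out-ports at [v] and two in-ports at [w], and [kappa_lift] adds 1 to four terms. *)
Lemma block_off_ge v w : v != w -> 5 + 4 * kappa D v w <= block v w.
Proof.
move=> vw; have [a [b [c t]]] := triangle_triple v.
have [a' [b' [c' t']]] := triangle_triple w; rewrite (block_off vw t t').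
have /andP[o2 _] := strong_degrees v; have /andP[_ i2] := strong_degrees w.
have ko := kappa_out D vw; have ki := kappa_in D vw.
have := out_in_degree w e_sym e_cubic eD.
have bound (x y : V) : (val x).1 = v -> (val y).1 = w ->
    1 + (1 < kappa D v w) * ((val x \in D) * (val y \notin D)) <= kappa F x y.
  move=> xv yw; have xy : x != y by apply: contraNneq vw => xy; rewrite -xv -yw xy.
  have := inflation_kappa_gt0 xy.
  have [k1|//] := boolP (1 < kappa D v w).
  have [xD|//] := boolP (val x \in D); have [//|yD] := boolP (val y \in D) => _.
  by apply: (kappa_lift eD eF FD) => //; rewrite ?xv ?yw.
have va := triple_port t; have vb := triple_port (triple_rot t).
have vc := triple_port (triple_rot (triple_rot t)).
have wa := triple_port t'; have wb := triple_port (triple_rot t').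
have wc := triple_port (triple_rot (triple_rot t')).
have := out_ports eD t; have := out_ports eD t'.
have := bound _ _ va wa; have := bound _ _ va wb; have := bound _ _ va wc.
have := bound _ _ vb wa; have := bound _ _ vb wb; have := bound _ _ vb wc.
have := bound _ _ vc wa; have := bound _ _ vc wb; have := bound _ _ vc wc.
clear bound va vb vc wa wb wc.
move: ko ki o2 i2; move: (kappa D v w) #|outn D v| => k o.
move: #|inn D w| #|outn D w| => i' o'; move: (kappa F) => l.
have [k1|k1] := boolP (1 < k); last by rewrite !mul0n !addn0; lia.
by do 6!case: (_ \in D); rewrite /= ?muln0 ?muln1 ?mul1n; lia.
Qed.

Lemma total_inflation :
  total F = 8 * #|T| + 5 * (#|T| * #|T|.-1) + 4 * total D.
Proof.
apply/eqP; rewrite eqn_leq total_inflation_le total_blocks -addnA leq_add //.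
  rewrite mulnC -sum_nat_const; apply: leq_sum => v _; exact: block_diag_ge.
rewrite -sum_const_neq /total big_distrr -big_split /=; apply: leq_sum => v _.
rewrite big_distrr -big_split /=; apply: leq_sum => w.
by rewrite eq_sym; apply: block_off_ge.
Qed.

End Blocks.

(** * Contracting orientations of the inflation *)

Definition projection (F : {set V * V}) : {set T * T} :=
  [set val a | a : V & (a, flip a) \in F].

(** Makes the block bounds apply to an arbitrary orientation [F], with [projection F] as [D]. *)
Lemma projectionE (F : {set V * V}) a : ((a, flip a) \in F) = (val a \in projection F).
Proof.
apply/idP/imsetP => [aF|[b + /val_inj ->]]; last by rewrite inE.
by exists a; rewrite ?inE.
Qed.

Lemma projection_orientation (F : {set V * V}) : orientation (@inflation T e) F ->
  orientation e (projection F).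
Proof.
move=> eF; apply/forallP => x; apply/forallP => y; case: ifP => exy.
  pose a : V := exist (fun p => e p.1 p.2) (x, y) exy.
  have := orientation_arc eF (x := a) (y := flip a).
  rewrite inflationE eqxx orbT -{2}[a]flipK !projectionE => /(_ isT) /= ->.
  by case: (_ \in _).
apply: contraFN exy => /imsetP[a _ axy]; have := valP a.
by rewrite -axy.
Qed.

(** For the converse of the lifting condition: if [val a] is not in [D], the reverse arc is, and it
    lifts to an arc from [flip a] to [a]. *)
Lemma lifting_arcs (D : {set T * T}) (F : {set V * V}) :
  orientation e D -> lifting D F ->
  forall a, ((a, flip a) \in F) = (val a \in D).
Proof.
move=> eD [eF lF] a; apply/idP/idP => [aF|]; last exact: lF.
apply: contraT => aD; have := orientation_asym (@inflation_sym T e) eF aF.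
rewrite (lF (flip a) a) ?flipK //=; first by case: (val a).
by rewrite val_in.
Qed.

Lemma card_inflation : #|{: V}| = 3 * #|T|.
Proof.
rewrite -sum1_card (partition_big (fun a => (val a).1) predT) //=.
rewrite mulnC -sum_nat_const; apply: eq_bigr => v _.
by rewrite sum1_card -(card_triangle v); apply: eq_card => a; rewrite !inE.
Qed.

End InflationTheory.

(** * Average connectivity and optimality *)

Local Open Scope ring_scope.

Lemma kappa_barE (T : finType) (D : {set T * T}) :
  kappa_bar D = (total D)%:R / (#|T|%:R * (#|T|%:R - 1)).
Proof.
rewrite /kappa_bar /total natr_sum; congr (_ / _).
by apply: eq_bigr => u _; rewrite natr_sum.
Qed.

Lemma kappa_bar_max_ge (T : finType) (e : rel T) (D : {set T * T}) :
  orientation e D -> kappa_bar D <= kappa_bar_max e.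
Proof. by move=> eD; apply: (le_bigmax_cond 0 (@kappa_bar T)). Qed.

Lemma kappa_bar_le (T : finType) (D D' : {set T * T}) : (1 < #|T|)%N ->
  (kappa_bar D <= kappa_bar D') = (total D <= total D')%N.
Proof.
move=> T1; rewrite !kappa_barE ler_pM2r ?ler_nat // invr_gt0 mulr_gt0 //.
  by rewrite ltr0n ltnW.
by rewrite subr_gt0 ltr1n.
Qed.

Theorem theorem3p6 (T : finType) (e : rel T) (n : nat)
    (e_sym : symmetric e) (e_irr : irreflexive e)
    (G_cubic : cubic e) (G_3conn : k_connected e 3) (G_order : #|T| = n)
    (D : {set T * T}) (D_strong : strong D) (D_opt : optimal e D)
    (F : {set inflation_vertex e * inflation_vertex e})
    (F_lift : lifting D F) (F_cyc : forall v : T, cyclic_triangle F v) :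
  [/\ strong F,
      optimal (@inflation T e) F,
      kappa_bar_max (@inflation T e) = kappa_bar F
    & kappa_bar F =
        1 + (4 * n%:R * (n%:R - 1) * (kappa_bar_max e - 1) + 2 * n%:R)
              / (3 * n%:R * (3 * n%:R - 1)) :> rat].
Proof.
have [eD D_max] := D_opt; have [eF _] := F_lift.
have FD := lifting_arcs e_sym eD F_lift.
have T3 : (3 < #|T|)%N by case: G_3conn.
have T1 : (1 < #|T|)%N by apply: leq_trans T3.
have V1 : (1 < #|{: inflation_vertex e}|)%N.
  by rewrite card_inflation //; apply: (leq_trans T1); rewrite leq_pmull.
have totalF := total_inflation e_irr G_cubic eD eF FD F_cyc D_strong.
have F_max : kappa_bar_max (@inflation T e) = kappa_bar F.
  apply/le_anti; rewrite kappa_bar_max_ge // andbT.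
  apply: bigmax_le => [|F' eF'].
    (* The default 0 of the maximum must not exceed [kappa_bar F]. *)
    rewrite kappa_barE divr_ge0 ?ler0n // mulr_ge0 ?ler0n // subr_ge0.
    by rewrite ler1n ltnW.
  (* The upper bound controls [F'] by its contraction, whose total is at most that of the optimal
     [D]. *)
  have eD' := projection_orientation e_sym eF'.
  rewrite kappa_bar_le // totalF.
  apply: (leq_trans (total_inflation_le e_irr G_cubic eD' eF' (projectionE e_sym F'))).
  by rewrite leq_add2l leq_mul2l /= -kappa_bar_le // D_max kappa_bar_max_ge.
split=> //; first exact: (inflation_strong eD FD F_cyc D_strong).
rewrite -D_max !kappa_barE totalF card_inflation // G_order.
(* Writing the order as [m.+1] removes the truncated predecessor before the cast to [rat]. *)
rewrite G_order in T3; case: n T3 {G_order} => // m m3.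
rewrite !natrD !natrM /= -natr1.
have m0 : m%:R != 0 :> rat by rewrite pnatr_eq0 -lt0n ltnW // ltnW.
have m1 : m%:R + 1 != 0 :> rat by rewrite natr1 pnatr_eq0.
have m2 : 3 * (m%:R + 1) - 1 != 0 :> rat.
  rewrite (_ : 3 * (m%:R + 1) - 1 = (3 * m + 2)%:R); first by rewrite pnatr_eq0 addn2.
  by rewrite natrD natrM; ring.
by field; rewrite [1 + _]addrC addrK m0 m1 m2.
Qed.
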